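(* Let $(A,m,u,\Delta,\varepsilon,\Phi,S)$ be a quasi-bialgebra with preantipode over a field $\Bbbk$. If $A$ is commutative, then, with $s(a):=\Phi^1S(a\Phi^2)\Phi^3$ for all $a\in A$, $\alpha:=1$ and $\beta:=S(1)$: $(A,m,u,\Delta,\varepsilon,s)$ is an ordinary Hopf algebra; $(A,m,u,\Delta,\varepsilon,\Phi,s,\alpha,\beta)$ is a quasi-Hopf algebra; and $S(a)=\beta s(a)$ for all $a\in A$. In particular, $A$ is an ordinary Hopf algebra.
   Context: $\Bbbk$ is a field, $\otimes=\otimes_\Bbbk$; Sweedler notation $\Delta(a)=a_1\otimes a_2$ (summation understood). Quasi-bialgebra: $(A,m,u)$ is an associative unital $\Bbbk$-algebra, $\Delta\colon A\to A\otimes A$ and $\varepsilon\colon A\to\Bbbk$ are algebra maps, $\Phi=\Phi^1\otimes\Phi^2\otimes\Phi^3\in A\otimes A\otimes A$ is invertible with inverse $\Phi^{-1}=\phi^1\otimes\phi^2\otimes\phi^3$, and, writing $A$ for $\mathrm{Id}_A$: $(A\otimes A\otimes\Delta)(\Phi)\cdot(\Delta\otimes A\otimes A)(\Phi)=(1\otimes\Phi)\cdot(A\otimes\Delta\otimes A)(\Phi)\cdot(\Phi\otimes1)$; $(\varepsilon\otimes A\otimes A)(\Phi)=(A\otimes\varepsilon\otimes A)(\Phi)=(A\otimes A\otimes\varepsilon)(\Phi)=1\otimes1$; $(A\otimes\Delta)(\Delta(a))\cdot\Phi=\Phi\cdot(\Delta\otimes A)(\Delta(a))$; $\varepsilon(a_1)a_2=a=a_1\varepsilon(a_2)$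 for all $a\in A$. A preantipode for $A$ is a $\Bbbk$-linear map $S\colon A\to A$ such that, for all $a,b\in A$, $a_1S(ba_2)=\varepsilon(a)S(b)$, $S(a_1b)a_2=\varepsilon(a)S(b)$, and $\Phi^1S(\Phi^2)\Phi^3=1$. A quasi-Hopf algebra is a quasi-bialgebra with elements $\alpha,\beta\in A$ and an antimultiplicative ($\Bbbk$-linear, $s(ab)=s(b)s(a)$) endomorphism $s$ of $A$ such that for all $a\in A$: $s(a_1)\alpha a_2=\varepsilon(a)\alpha$, $a_1\beta s(a_2)=\varepsilon(a)\beta$, $\Phi^1\beta s(\Phi^2)\alpha\Phi^3=1$, $s(\phi^1)\alpha\phi^2\beta s(\phi^3)=1$. *)

(* Defs.v *)
From HB Require Import structures.
From mathcomp Require Import all_boot all_algebra.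
From mathcomp Require Import boolp classical_sets.

Set Implicit Arguments.
Unset Strict Implicit.
Unset Printing Implicit Defensive.

Import GRing.Theory.
Local Open Scope ring_scope.
Local Open Scope quotient_scope.

Notation is_bilinear f := (bilinear_for *:%R *:%R f).

(* The tensor product U ⊗ V over a field is the quotient of the commutative
   monoid of finite formal sums of pairs, written as lists, by the bilinearity
   relations.  The clause tens_eqv0 is needed because the free object here is
   only a monoid. *)
Section TensorProduct.
Variables (k : fieldType) (U V : lmodType k).

Inductive tens_eqv : seq (U * V) -> seq (U * V) -> Prop :=
| tens_eqv_refl s : tens_eqv s s
| tens_eqv_sym s t : tens_eqv s t -> tens_eqv t s
| tens_eqv_trans s t r : tens_eqv s t -> tens_eqv t r -> tens_eqv s r
| tens_eqv_cat s s' t t' :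
    tens_eqv s s' -> tens_eqv t t' -> tens_eqv (s ++ t) (s' ++ t')
| tens_eqvC s t : tens_eqv (s ++ t) (t ++ s)
| tens_eqv0 v : tens_eqv [:: (0, v)] [::]
| tens_eqvDl u u' v : tens_eqv [:: (u + u', v)] [:: (u, v); (u', v)]
| tens_eqvDr u v v' : tens_eqv [:: (u, v + v')] [:: (u, v); (u, v')]
| tens_eqvZ c u v : tens_eqv [:: (c *: u, v)] [:: (u, c *: v)].

Definition tens_rel (s t : seq (U * V)) : bool := `[< tens_eqv s t >].

Lemma tens_relP : equiv_class_of tens_rel.
Proof.
split.
- by move=> s; apply/asboolP; apply: tens_eqv_refl.
- by move=> s t; apply/asboolP/asboolP; apply: tens_eqv_sym.
- move=> t s r /asboolP st /asboolP tr; apply/asboolP.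
  exact: tens_eqv_trans st tr.
Qed.

Canonical tens_equiv := EquivRelPack tens_relP.

Definition tensor : Type := {eq_quot tens_equiv}.

HB.instance Definition _ := Choice.on tensor.
HB.instance Definition _ := EqQuotient.on tensor.

Definition tens_pi (s : seq (U * V)) : tensor := \pi_tensor s.

Definition tens (u : U) (v : V) : tensor := tens_pi [:: (u, v)].

(* Some representation t = \sum_i u_i ⊗ v_i, as in Sweedler notation. *)
Definition tens_repr (t : tensor) : seq (U * V) := repr t.

Local Notation "s ~ t" := (tens_eqv s t) (at level 70).

Lemma tens_piP s t : s ~ t <-> tens_pi s = tens_pi t.
Proof. by split=> [st | /eqmodP/asboolP //]; apply/eqmodP/asboolP. Qed.

Lemma tens_repr_pi s : tens_repr (tens_pi s) ~ s.
Proof. by apply/tens_piP; apply: reprK. Qed.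

Lemma tens_piK t : tens_pi (tens_repr t) = t.
Proof. exact: reprK. Qed.

Let scal (c : k) (s : seq (U * V)) := [seq (c *: p.1, p.2) | p <- s].

Let scal_eqv c s t : s ~ t -> scal c s ~ scal c t.
Proof.
elim=> {s t}.
- by move=> s; apply: tens_eqv_refl.
- by move=> s t _; apply: tens_eqv_sym.
- by move=> s t r _ st _; apply: tens_eqv_trans st.
- by move=> s s' t t' _ st _ st'; rewrite /scal !map_cat; apply: tens_eqv_cat.
- by move=> s t; rewrite /scal !map_cat; apply: tens_eqvC.
- by move=> v /=; rewrite scaler0; apply: tens_eqv0.
- by move=> u u' v /=; rewrite scalerDr; apply: tens_eqvDl.
- by move=> u v v' /=; apply: tens_eqvDr.
- by move=> d u v /=; rewrite scalerA mulrC -scalerA; apply: tens_eqvZ.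
Qed.

Let add (t r : tensor) : tensor := tens_pi (tens_repr t ++ tens_repr r).
Let zero : tensor := tens_pi [::].
Let scale (c : k) (t : tensor) : tensor := tens_pi (scal c (tens_repr t)).
Let opp : tensor -> tensor := scale (-1).

Let addE s t : add (tens_pi s) (tens_pi t) = tens_pi (s ++ t).
Proof. by apply/tens_piP; apply: tens_eqv_cat; apply: tens_repr_pi. Qed.

Let scaleE c s : scale c (tens_pi s) = tens_pi (scal c s).
Proof. by apply/tens_piP; apply: scal_eqv; apply: tens_repr_pi. Qed.

Let tensW (P : tensor -> Prop) : (forall s, P (tens_pi s)) -> forall t, P t.
Proof. by move=> Ps t; rewrite -(tens_piK t). Qed.

Let addA : associative add.
Proof. by do 3![elim/tensW=> ?]; rewrite !addE catA. Qed.

Let addC : commutative add.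
Proof.
by do 2![elim/tensW=> ?]; rewrite !addE; apply/tens_piP; apply: tens_eqvC.
Qed.

Let add0 : left_id zero add.
Proof. by elim/tensW=> ?; rewrite !addE. Qed.

Let pair_sumZ (c d : k) s : scal c s ++ scal d s ~ scal (c + d) s.
Proof.
elim: s => [|[u v] s IHs] /=; first exact: tens_eqv_refl.
rewrite scalerDl -(cat1s _ (scal (c + d) s)).
apply: tens_eqv_trans (tens_eqv_cat (tens_eqv_sym (tens_eqvDl _ _ _)) IHs).
rewrite -cat1s -[_ :: scal d s]cat1s catA.
apply: (@tens_eqv_trans _
  (([:: (c *: u, v)] ++ [:: (d *: u, v)] ++ scal c s) ++ scal d s)).
  rewrite -!catA; apply: tens_eqv_cat; first exact: tens_eqv_refl.
  rewrite !catA; apply: tens_eqv_cat; last exact: tens_eqv_refl.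
  exact: tens_eqvC.
by rewrite /= -?catA /=; apply: tens_eqv_refl.
Qed.

Let scal0 s : scal 0 s ~ [::].
Proof.
elim: s => [|[u v] s IHs] /=; first exact: tens_eqv_refl.
by rewrite scale0r -cat1s; apply: (tens_eqv_cat (tens_eqv0 v) IHs).
Qed.

Let scal1 s : scal 1 s = s.
Proof. by elim: s => [|[u v] s /= ->] //=; rewrite scale1r. Qed.

Let addN : left_inverse zero opp add.
Proof.
elim/tensW=> s; rewrite /opp scaleE addE; apply/tens_piP.
rewrite -{2}(scal1 s); apply: tens_eqv_trans (pair_sumZ _ _ _) _.
by rewrite addNr; apply: scal0.
Qed.

HB.instance Definition _ :=
  GRing.isZmodule.Build tensor addA addC add0 addN.

Let addrE s t : tens_pi s + tens_pi t = tens_pi (s ++ t).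
Proof. exact: addE. Qed.

Let scaleA c d (t : tensor) : scale c (scale d t) = scale (c * d) t.
Proof.
elim/tensW: t => s; rewrite !scaleE; congr (tens_pi _).
by rewrite /scal -map_comp; apply: eq_map => p /=; rewrite scalerA.
Qed.

Let scale1 : left_id 1 scale.
Proof. by elim/tensW=> s; rewrite scaleE scal1. Qed.

Let scaleDr : right_distributive scale +%R.
Proof.
by move=> c; do 2![elim/tensW=> ?]; rewrite addrE !scaleE addrE /scal map_cat.
Qed.

Let scaleDl (t : tensor) : {morph scale^~ t : c d / c + d}.
Proof.
move=> c d; elim/tensW: t => s; rewrite !scaleE; apply/esym.
by rewrite addrE; apply/tens_piP; apply: pair_sumZ.
Qed.

HB.instance Definition _ :=
  GRing.Zmodule_isLmodule.Build k tensor scaleA scale1 scaleDr scaleDl.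

Let scalerE c s : c *: tens_pi s = tens_pi (scal c s).
Proof. exact: scaleE. Qed.

Lemma tens_piE s : tens_pi s = \sum_(p <- s) tens p.1 p.2 :> tensor.
Proof.
elim: s => [|[u v] s IHs]; first by rewrite big_nil.
by rewrite big_cons -IHs addrE.
Qed.

Lemma tens_reprK (t : tensor) : \sum_(p <- tens_repr t) tens p.1 p.2 = t.
Proof. by rewrite -tens_piE tens_piK. Qed.

Lemma tens_bilinear : is_bilinear tens.
Proof.
split=> [v c u u' | u c v v'] /=.
  rewrite scalerE addrE.
  by apply/tens_piP; apply: tens_eqvDl.
rewrite scalerE addrE; apply/tens_piP.
apply: tens_eqv_trans (tens_eqvDr _ _ _) _; rewrite -cat1s -[X in _ ~ X]cat1s.
apply: tens_eqv_cat; last exact: tens_eqv_refl.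
by apply: tens_eqv_sym; apply: tens_eqvZ.
Qed.

(* The value at t = u_1 ⊗ v_1 + ... + u_n ⊗ v_n of the linear map induced by f;
   it depends on the chosen representation of t unless f is bilinear. *)
Definition tlift (W : lmodType k) (f : U -> V -> W) (t : tensor) : W :=
  \sum_(p <- tens_repr t) f p.1 p.2.

Section Universal.
Variables (W : lmodType k) (f : U -> V -> W).
Hypothesis f_bil : is_bilinear f.

Lemma tlift_pi s : tlift f (tens_pi s) = \sum_(p <- s) f p.1 p.2.
Proof.
rewrite /tlift; move: (tens_repr_pi s); move: (tens_repr _) => r.
have [fl fr] := f_bil.
have f0 v : f 0 v = 0.
  by have := fl v (-1) 0 0; rewrite /= scaler0 addr0 scaleN1r addNr.
elim=> {s r}.
- by [].
- by move=> s t _ ->.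
- by move=> s t r _ -> _ ->.
- by move=> s s' t t' _ e _ e'; rewrite !big_cat /= e e'.
- by move=> s t; rewrite !big_cat /= addrC.
- by move=> v; rewrite big_seq1 big_nil /= f0.
- move=> u u' v; rewrite !big_cons big_nil /= !addr0.
  by have := fl v 1 u u'; rewrite /= !scale1r.
- move=> u v v'; rewrite !big_cons big_nil /= !addr0.
  by have := fr u 1 v v'; rewrite /= !scale1r.
- move=> c u v; rewrite !big_seq1 /=.
  have := fl v c u 0; rewrite /= addr0 f0 addr0 => ->.
  have f0' : f u 0 = 0.
    by have := fr u (-1) 0 0; rewrite /= scaler0 addr0 scaleN1r addNr.
  by have := fr u c v 0; rewrite /= addr0 f0' addr0 => ->.
Qed.

Lemma tlift_tens u v : tlift f (tens u v) = f u v.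
Proof. by rewrite tlift_pi big_seq1. Qed.

Lemma tlift_linear : linear (tlift f).
Proof.
move=> c; do 2![elim/tensW=> ?].
rewrite scalerE addrE !tlift_pi.
rewrite big_cat big_map /= scaler_sumr; congr (_ + _); apply: eq_bigr => p _.
have [fl _] := f_bil.
have f0 : f 0 p.2 = 0.
  by have := fl p.2 (-1) 0 0; rewrite /= scaler0 addr0 scaleN1r addNr.
by have := fl p.2 c p.1 0; rewrite /= f0 !addr0.
Qed.

End Universal.

Lemma tensor_ext (W : lmodType k) (g h : tensor -> W) :
  linear g -> linear h ->
  (forall u v, g (tens u v) = h (tens u v)) -> g =1 h.
Proof.
move=> lg lh gh t; rewrite -(tens_reprK t).
have l0 (e : tensor -> W) : linear e -> e 0 = 0.
  by move=> le; have := le (-1) 0 0; rewrite scaler0 addr0 scaleN1r addNr.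
elim: (tens_repr t) => [|p s IHs]; first by rewrite big_nil !l0.
rewrite big_cons; have := lg 1 (tens p.1 p.2); rewrite scale1r => ->.
by have := lh 1 (tens p.1 p.2); rewrite scale1r => ->; rewrite IHs gh.
Qed.

End TensorProduct.

Notation "U ⊗ V" := (tensor U%type V%type) (at level 40, left associativity) : type_scope.
Notation "u ⊗ v" := (tens u v) (at level 40, left associativity) : ring_scope.

Lemma tens_linearl (k : fieldType) (U V : lmodType k) (v : V) :
  linear (fun u : U => u ⊗ v).
Proof. exact: (tens_bilinear U V).1. Qed.

Lemma tens_linearr (k : fieldType) (U V : lmodType k) (u : U) :
  linear (fun v : V => u ⊗ v).
Proof. exact: (tens_bilinear U V).2. Qed.

Lemma exists_dual_functional (k : fieldType) (V : lmodType k) (v : V) :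
  v != 0 -> exists f : V -> k^o, linear f /\ f v = 1.
Proof.
move=> v0.
pose lin (M : set V) := forall c x y, M x -> M y -> M (c *: x + y).
pose P (M : set V) := lin M /\ ~ M v.
have [|M [[linM Mv] maxM]] := @Zorn_bigcup V P.
  move=> F FP totF; split=> [c x y [X FX Xx] [Y FY Yy]|[X FX Xv]]; last first.
    by have [_] := FP _ FX.
  have [XY|YX] := totF _ _ FX FY.
    by exists Y => //; have [l _] := FP _ FY; apply: l => //; apply: XY.
  by exists X => //; have [l _] := FP _ FX; apply: l => //; apply: YX.
pose N x := x = 0 \/ M x.
have N0 : N 0 by left.
have MZ c x : M x -> N (c *: x).
  move=> Mx; right; have := linM (c - 1) x x Mx Mx.
  by rewrite -[X in _ + X]scale1r -scalerDl subrK.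
have linN : lin N.
  move=> c x y [->|Mx] Ny; first by rewrite scaler0 add0r.
  case: Ny => [->|My]; first by rewrite addr0; apply: MZ.
  by right; apply: linM.
have NZ c x : N x -> N (c *: x).
  by move=> Nx; rewrite -[X in N X]addr0; apply: linN.
have Nv : ~ N v by case=> // /eqP; apply/negP.
have dec x : exists c : k, N (x - c *: v).
  apply: contrapT => nex.
  pose B : set V := fun y => exists c : k, N (y - c *: x).
  apply: (maxM B).
    split=> [y My|BM].
      by exists 0; rewrite scale0r subr0; right.
    have Mx : M x by apply: BM; exists 1; rewrite scale1r subrr.
    by apply: nex; exists 0; rewrite scale0r subr0; right.
  split=> [c y z [d Nd] [e Ne]|[c Nc]].
    exists (c * d + e).
    have -> : c *: y + z - (c * d + e) *: x
      = c *: (y - d *: x) + (z - e *: x).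
      by rewrite scalerBr scalerDl opprD -scalerA addrACA.
    exact: linN.
  have [c0|c0] := eqVneq c 0.
    by apply: Nv; move: Nc; rewrite c0 scale0r subr0.
  apply: nex; exists c^-1.
  have -> : x - c^-1 *: v = (- c^-1) *: (v - c *: x).
    by rewrite scalerBr !scaleNr opprK scalerA mulVf // scale1r addrC.
  exact: NZ.
have uni x c d : N (x - c *: v) -> N (x - d *: v) -> c = d.
  move=> Nc Nd; apply/eqP; rewrite -subr_eq0; apply/negP=> /negP cd.
  have Ncd : N ((c - d) *: v).
    have -> : (c - d) *: v = (-1) *: (x - c *: v) + (x - d *: v).
      by rewrite scaleN1r opprB addrA subrK scalerBl.
    exact: linN.
  apply: Nv; have := NZ (c - d)^-1 _ Ncd.
  by rewrite scalerA mulVf // scale1r.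
have [f fP] := choice dec.
exists f; split=> [c x y|].
  apply: (uni (c *: x + y)) => //.
  have -> : c *: x + y - (c *: (f x : k^o) + f y) *: v
    = c *: (x - f x *: v) + (y - f y *: v).
    by rewrite scalerBr scalerDl opprD scalerA addrACA.
  exact: linN.
by apply: (uni v) => //; rewrite scale1r subrr.
Qed.

Lemma tens_neq0 (k : fieldType) (U V : lmodType k) (u : U) (v : V) :
  u != 0 -> v != 0 -> u ⊗ v != 0.
Proof.
move=> /exists_dual_functional[f [lf fu]] /exists_dual_functional[g [lg gv]].
pose h (x : U) (y : V) : k^o := f x * g y.
have h_bil : is_bilinear h.
  split=> [y c x x'|x c y y'] /=; rewrite /h.
    by rewrite lf mulrDl -[c *: f x]/(c * f x) -mulrA.
  by rewrite lg mulrDr -[c *: g y]/(c * g y) mulrCA.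
apply/eqP=> uv0; have := tlift_tens h_bil u v.
have := tlift_linear h_bil (-1) 0 0.
rewrite uv0 scaler0 addr0 scaleN1r addNr => ->.
by rewrite /h fu gv mulr1 => /eqP; rewrite eq_sym oner_eq0.
Qed.

(* (a ⊗ b) * (a' ⊗ b') = (a * a') ⊗ (b * b') *)
Section TensorAlgebra.
Variables (k : fieldType) (A B : algType k).
Local Notation T := (A ⊗ B)%type.

Definition tens_mul (t r : T) : T :=
  tlift (fun a b => tlift (fun a' b' => (a * a') ⊗ (b * b')) r) t.

Let lin0 (W W' : lmodType k) (f : W -> W') : linear f -> f 0 = 0.
Proof.
by move=> le; have := le (-1) 0 0; rewrite scaler0 addr0 scaleN1r addNr.
Qed.

Let inner_bil a b : is_bilinear (fun (a' : A) (b' : B) => (a * a') ⊗ (b * b')).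
Proof.
split=> [y c x x'|x c y y'] /=; rewrite mulrDr -scalerAr.
  exact: tens_linearl.
exact: tens_linearr.
Qed.

Let outer_bil (r : T) : is_bilinear
  (fun (a : A) (b : B) => tlift (fun a' b' => (a * a') ⊗ (b * b')) r).
Proof.
split=> [y c x x'|x c y y'] /=; rewrite /tlift scaler_sumr -big_split;
  apply: eq_bigr => p _ /=; rewrite mulrDl -scalerAl.
  exact: tens_linearl.
exact: tens_linearr.
Qed.

Lemma tens_mulE a b a' b' :
  tens_mul (a ⊗ b) (a' ⊗ b') = (a * a') ⊗ (b * b').
Proof. by rewrite /tens_mul tlift_tens ?tlift_tens. Qed.

Let mul_linearl r : linear (tens_mul^~ r).
Proof. exact: tlift_linear. Qed.

Let mul_linearr t : linear (tens_mul t).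
Proof.
have E r : tens_mul t r = \sum_(p <- tens_repr t)
    tlift (fun a' b' => (p.1 * a') ⊗ (p.2 * b')) r by [].
move=> c r r'; rewrite !E scaler_sumr -big_split.
by apply: eq_bigr => p _; apply: tlift_linear.
Qed.

Let comp_lin (W W' W'' : lmodType k) (g : W' -> W'') (f : W -> W') :
  linear g -> linear f -> linear (fun x => g (f x)).
Proof. by move=> lg lf c x y; rewrite lf lg. Qed.

Let mulA : associative tens_mul.
Proof.
move=> x y z; move: x; apply: tensor_ext => [||a b].
- exact: mul_linearl.
- exact: (comp_lin (mul_linearl z) (mul_linearl y)).
move: y; apply: tensor_ext => [||a' b'].
- exact: (comp_lin (mul_linearr _) (mul_linearl z)).
- exact: (comp_lin (mul_linearl z) (mul_linearr _)).
move: z; apply: tensor_ext => [||a'' b''].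
- exact: (comp_lin (mul_linearr _) (mul_linearr _)).
- exact: mul_linearr.
by rewrite !tens_mulE !mulrA.
Qed.

Let mul1 : left_id (1 ⊗ 1) tens_mul.
Proof. by apply: tensor_ext => // a b; rewrite tens_mulE !mul1r. Qed.

Let mulx1 : right_id (1 ⊗ 1) tens_mul.
Proof. by apply: tensor_ext => // a b; rewrite tens_mulE !mulr1. Qed.

Let mulDl : left_distributive tens_mul +%R.
Proof. by move=> x y z; have := mul_linearl z 1 x y; rewrite !scale1r. Qed.

Let mulDr : right_distributive tens_mul +%R.
Proof. by move=> x y z; have := mul_linearr x 1 y z; rewrite !scale1r. Qed.

Let one_neq0 : (1 ⊗ 1 : T) != 0.
Proof. by apply: tens_neq0; apply: oner_neq0. Qed.

HB.instance Definition _ :=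
  GRing.Zmodule_isNzRing.Build T mulA mul1 mulx1 mulDl mulDr one_neq0.

Let mul_scalel c (x y : T) : c *: (x * y) = (c *: x) * y.
Proof.
by have := mul_linearl y c x 0; rewrite addr0 (lin0 (mul_linearl y)) addr0.
Qed.

HB.instance Definition _ := GRing.Lmodule_isLalgebra.Build k T mul_scalel.

Let mul_scaler c (x y : T) : c *: (x * y) = x * (c *: y).
Proof.
by have := mul_linearr x c y 0; rewrite addr0 (lin0 (mul_linearr x)) addr0.
Qed.

HB.instance Definition _ := GRing.Lalgebra_isAlgebra.Build k T mul_scaler.

Lemma tensM (a a' : A) (b b' : B) : (a ⊗ b) * (a' ⊗ b') = (a * a') ⊗ (b * b').
Proof. exact: tens_mulE. Qed.

Lemma tens1 : 1 = 1 ⊗ 1 :> T.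
Proof. by []. Qed.

End TensorAlgebra.

Section TensorMaps.
Variable k : fieldType.

Definition tmap (U V U' V' : lmodType k) (f : U -> U') (g : V -> V') :
    U ⊗ V -> U' ⊗ V' :=
  tlift (fun u v => f u ⊗ g v).

(* u ⊗ (v ⊗ w) |-> (u ⊗ v) ⊗ w *)
Definition tassoc (U V W : lmodType k) : U ⊗ (V ⊗ W) -> U ⊗ V ⊗ W :=
  tlift (fun u => tlift (fun v w => u ⊗ v ⊗ w)).

Definition tlift3 (U V W X : lmodType k) (f : U -> V -> W -> X) :
    U ⊗ V ⊗ W -> X :=
  tlift (fun t w => tlift (fun u v => f u v w) t).

Let lin_comp (U V W : lmodType k) (g : V -> W) (f : U -> V) :
  linear g -> linear f -> linear (fun u => g (f u)).
Proof. by move=> lg lf c x y; rewrite lf lg. Qed.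

Lemma tmap_tens (U V U' V' : lmodType k) (f : U -> U') (g : V -> V') u v :
  linear f -> linear g -> tmap f g (u ⊗ v) = f u ⊗ g v.
Proof.
move=> lf lg; apply: (tlift_tens (f := fun u v => f u ⊗ g v)); split=> w.
  exact: (lin_comp (tens_linearl _) lf).
exact: (lin_comp (tens_linearr _) lg).
Qed.

Lemma tassoc_tens (U V W : lmodType k) (u : U) (v : V) (w : W) :
  tassoc (u ⊗ (v ⊗ w)) = u ⊗ v ⊗ w.
Proof.
have bil x : is_bilinear (fun (v : V) (w : W) => x ⊗ v ⊗ w : U ⊗ V ⊗ W).
  split=> y; last exact: tens_linearr.
  exact: (lin_comp (tens_linearl y) (tens_linearr x)).
rewrite /tassoc tlift_tens ?tlift_tens //; split=> x; last exact: tlift_linear.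
move=> c y z /=; rewrite /tlift scaler_sumr -big_split; apply: eq_bigr => p _.
exact: (lin_comp (tens_linearl p.2) (tens_linearl p.1)).
Qed.

Lemma tlift3_tens (U V W X : lmodType k) (f : U -> V -> W -> X) u v w :
  (forall v w, linear (fun u => f u v w)) ->
  (forall u w, linear (fun v => f u v w)) ->
  (forall u v, linear (fun w => f u v w)) ->
  tlift3 f (u ⊗ v ⊗ w) = f u v w.
Proof.
move=> l1 l2 l3.
have bil z : is_bilinear (fun u v => f u v z) by split=> y; [exact: l1|exact: l2].
rewrite /tlift3 tlift_tens ?(tlift_tens (bil w)) //.
split=> x; first exact: tlift_linear.
move=> c y z /=; rewrite /tlift scaler_sumr -big_split; apply: eq_bigr => p _.
exact: l3.
Qed.

End TensorMaps.

(* All iterated tensor powers of A are left-nested, A ⊗ A ⊗ A standing for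
   (A ⊗ A) ⊗ A; tassoc is inserted wherever a map lands elsewhere. *)
Section Structures.
Variables (k : fieldType) (A : algType k).
Variables (Delta : {lrmorphism A -> A ⊗ A}) (eps : {lrmorphism A -> k | *%R}).

(* phi is the inverse of the reassociator Phi. *)
Record quasi_bialgebra (Phi phi : A ⊗ A ⊗ A) : Prop := QuasiBialgebra {
  qb_mulV : Phi * phi = 1;
  qb_Vmul : phi * Phi = 1;
  qb_pentagon :
    tassoc (tmap id Delta Phi) * tmap (tmap Delta id) id Phi
    = tmap (@tassoc k A A A) id (tassoc (1 ⊗ Phi))
      * tmap (@tassoc k A A A \o tmap id Delta) id Phi
      * (Phi ⊗ 1);
  qb_counit1 : tlift3 (fun x y z : A => eps x *: (y ⊗ z)) Phi = 1 ⊗ 1;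
  qb_counit2 : tlift3 (fun x y z : A => eps y *: (x ⊗ z)) Phi = 1 ⊗ 1;
  qb_counit3 : tlift3 (fun x y z : A => eps z *: (x ⊗ y)) Phi = 1 ⊗ 1;
  qb_coassoc : forall a : A,
    tassoc (tmap id Delta (Delta a)) * Phi = Phi * tmap Delta id (Delta a);
  qb_counitl : forall a : A, tlift (fun x y : A => eps x *: y) (Delta a) = a;
  qb_counitr : forall a : A, tlift (fun x y : A => eps y *: x) (Delta a) = a
}.

Record preantipode (Phi : A ⊗ A ⊗ A) (S : A -> A) : Prop := Preantipode {
  pa_linear : linear S;
  pa_left : forall a b : A,
    tlift (fun x y : A => x * S (b * y)) (Delta a) = eps a *: S b;
  pa_right : forall a b : A,
    tlift (fun x y : A => S (x * b) * y) (Delta a) = eps a *: S b;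
  pa_Phi : tlift3 (fun x y z : A => x * S y * z) Phi = 1
}.

Record quasi_hopf_algebra (Phi phi : A ⊗ A ⊗ A) (s : A -> A) (alpha beta : A)
    : Prop := QuasiHopfAlgebra {
  qh_quasi_bialgebra : quasi_bialgebra Phi phi;
  qh_linear : linear s;
  qh_antimul : forall a b : A, s (a * b) = s b * s a;
  qh_alpha : forall a : A,
    tlift (fun x y : A => s x * alpha * y) (Delta a) = eps a *: alpha;
  qh_beta : forall a : A,
    tlift (fun x y : A => x * beta * s y) (Delta a) = eps a *: beta;
  qh_Phi : tlift3 (fun x y z : A => x * beta * s y * alpha * z) Phi = 1;
  qh_phi : tlift3 (fun x y z : A => s x * alpha * y * beta * s z) phi = 1
}.

Record hopf_algebra (s : A -> A) : Prop := HopfAlgebra {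
  hopf_coassoc : forall a : A,
    tassoc (tmap id Delta (Delta a)) = tmap Delta id (Delta a);
  hopf_counitl : forall a : A, tlift (fun x y : A => eps x *: y) (Delta a) = a;
  hopf_counitr : forall a : A, tlift (fun x y : A => eps y *: x) (Delta a) = a;
  hopf_linear : linear s;
  hopf_antipodel : forall a : A, tlift (fun x y : A => s x * y) (Delta a) = (eps a)%:A;
  hopf_antipoder : forall a : A, tlift (fun x y : A => x * s y) (Delta a) = (eps a)%:A
}.

End Structures.

(* Main.v *)
Require Import Defs.
From mathcomp Require Import all_boot all_algebra.

Set Implicit Arguments.
Unset Strict Implicit.

Import GRing.Theory.
Local Open Scope ring_scope.

(** The idea is that commutativity makes the reassociator invisible wherever it
    acts by conjugation, and turns the remaining identities of a preantipode
    into identities between algebra maps with values in [A].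

    Since [A ⊗ A ⊗ A] is commutative and [Phi] is invertible, quasi-coassociativity
    is plain coassociativity ([coassoc_of_comm]), so [A] is a bialgebra.  In
    s(a) = Φ¹S(aΦ²)Φ³ the factors coming from [Phi] can be moved out of the way,
    so that s inherits from S the two identities a₁s(ba₂) = ε(a)s(b) and
    s(a₁b)a₂ = ε(a)s(b) ([twist_absorbl], [twist_absorbr]); at b = 1, where
    s(1) = Φ¹S(Φ²)Φ³ = 1, they are the antipode axioms.

    Any linear F with a₁F(ba₂) = ε(a)F(b) satisfies F(ba) = s(a)F(b), by
    evaluating s(a₁)a₂F(ba₃) in two ways ([absorb_antipode]).  For F = S and b = 1
    this is S(a) = S(1)s(a); for F = s it is the multiplicativity of s.

    The only remaining axiom is s(φ¹)φ²βs(φ³) = 1.  As s is an algebra map,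
    x⊗y⊗z⊗w ↦ s(x)ys(z)w is an algebra map on the fourth tensor power.
    It sends the pentagon to 1 = (Φ¹s(Φ²)Φ³)(s(Φ¹)Φ²s(Φ³)), because each of the
    three factors in which [Delta] is applied collapses to 1 by an antipode axiom
    and a counit axiom ([pentagon_antipode]).  Since βΦ¹s(Φ²)Φ³ = Φ¹S(Φ²)Φ³ = 1,
    it follows that β = s(Φ¹)Φ²s(Φ³), whose inverse is s(φ¹)φ²s(φ³). *)

(** * Linearity and sums *)

Section Linearity.
Variable k : fieldType.

Lemma lin_comp (U V W : lmodType k) (g : V -> W) (f : U -> V) :
  linear g -> linear f -> linear (fun u => g (f u)).
Proof. by move=> lg lf c x y; rewrite lf lg. Qed.

Lemma lin_mulr (U : lmodType k) (B : algType k) (f : U -> B) (b : B) :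
  linear f -> linear (fun u => f u * b).
Proof. by move=> lf c x y; rewrite lf mulrDl -scalerAl. Qed.

Lemma lin_mull (U : lmodType k) (B : algType k) (f : U -> B) (b : B) :
  linear f -> linear (fun u => b * f u).
Proof. by move=> lf c x y; rewrite lf mulrDr -scalerAr. Qed.

Lemma lin_scale (B : algType k) (eps : {lrmorphism B -> k | *%R})
  (W : lmodType k) (w : W) : linear (fun b => eps b *: w).
Proof. by move=> c x y; rewrite linearP scalerDl scalerA. Qed.

Lemma lin_scaler (V W : lmodType k) (c : k) (f : V -> W) :
  linear f -> linear (fun v => c *: f v).
Proof. by move=> lf d x y; rewrite lf scalerDr !scalerA mulrC. Qed.

Lemma linZ (V W : lmodType k) (g : V -> W) c v :
  linear g -> g (c *: v) = c *: g v.
Proof.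
move=> lg; have g0 : g 0 = 0.
  by have := lg (-1) 0 0; rewrite scaler0 addr0 scaleN1r addNr.
by have := lg c v 0; rewrite g0 !addr0.
Qed.

Lemma lin_sum (V W : lmodType k) (g : V -> W) (I : Type) (r : seq I)
    (F : I -> V) :
  linear g -> g (\sum_(i <- r) F i) = \sum_(i <- r) g (F i).
Proof.
move=> lg; apply: (big_morph g) => [x y|].
  by have := lg 1 x y; rewrite !scale1r.
by have := linZ 0 0 lg; rewrite !scale0r.
Qed.

Lemma linear_tlift (U V W X : lmodType k) (g : W -> X) (f : U -> V -> W) t :
  linear g -> g (tlift f t) = tlift (fun u v => g (f u v)) t.
Proof. exact: lin_sum. Qed.

Lemma linear_tlift3 (U V W X Y : lmodType k) (g : X -> Y)
    (f : U -> V -> W -> X) t :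
  linear g -> g (tlift3 f t) = tlift3 (fun u v w => g (f u v w)) t.
Proof.
by move=> lg; rewrite /tlift3 linear_tlift //; apply: eq_bigr => p _;
  rewrite linear_tlift.
Qed.

Lemma eq_tlift (U V W : lmodType k) (f g : U -> V -> W) :
  f =2 g -> tlift f =1 tlift g.
Proof. by move=> fg t; apply: eq_bigr => p _; rewrite fg. Qed.

Lemma eq_tlift3 (U V W X : lmodType k) (f g : U -> V -> W -> X) :
  (forall u v w, f u v w = g u v w) -> tlift3 f =1 tlift3 g.
Proof. by move=> fg t; apply: eq_tlift => p w; apply: eq_tlift => u v. Qed.

Lemma exchange_tlift3 (U V W U' V' X : lmodType k)
    (f : U' -> V' -> U -> V -> W -> X) t r :
  tlift (fun u' v' => tlift3 (f u' v') t) r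
  = tlift3 (fun u v w => tlift (fun u' v' => f u' v' u v w) r) t.
Proof.
rewrite /tlift3 /tlift exchange_big; apply: eq_bigr => p _.
by rewrite exchange_big.
Qed.

Lemma tassoc_linear (U V W : lmodType k) : linear (@tassoc k U V W).
Proof.
apply: tlift_linear; split=> x /=; last first.
  apply: tlift_linear; split=> y /=; last exact: tens_linearr.
  exact: (lin_comp (tens_linearl _) (tens_linearr _)).
move=> c y z /=; rewrite /tlift scaler_sumr -big_split; apply: eq_bigr => p _.
exact: (lin_comp (tens_linearl p.2) (tens_linearl p.1)).
Qed.

Lemma tmap_linear (U V U' V' : lmodType k) (f : U -> U') (g : V -> V') :
  linear f -> linear g -> linear (tmap f g).
Proof.
move=> lf lg; apply: tlift_linear; split=> x /=.
  exact: (lin_comp (tens_linearl _) lf).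
exact: (lin_comp (tens_linearr _) lg).
Qed.

End Linearity.

(** * Algebra maps on tensor products *)

Section CommutativeTarget.
Variable k : fieldType.

Lemma tens_comm (B C : algType k) :
  (forall x y : B, x * y = y * x) -> (forall x y : C, x * y = y * x) ->
  forall t r : B ⊗ C, t * r = r * t.
Proof.
move=> cB cC t r; move: t.
apply: tensor_ext => [||b c]; [exact: lin_mulr | exact: lin_mull |].
move: r; apply: tensor_ext => [||b' c']; [exact: lin_mull | exact: lin_mulr |].
by rewrite !tensM cB cC.
Qed.

(** A binary operation suffices, since its iterates are the product maps
    [x ⊗ y ⊗ z |-> f x * g y * h z] and so on for all left-nested tensor powers. *)
Definition tprod (U V : lmodType k) (B : algType k) (f : U -> B) (g : V -> B) :
    U ⊗ V -> B :=
  tlift (fun u v => f u * g v).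

Lemma tprod_tens (U V : lmodType k) (B : algType k) (f : U -> B) (g : V -> B)
    u v :
  linear f -> linear g -> tprod f g (u ⊗ v) = f u * g v.
Proof.
move=> lf lg; apply: (tlift_tens (f := fun u v => f u * g v)).
by split=> x; [exact: lin_mulr | exact: lin_mull].
Qed.

Lemma tprod_linear (U V : lmodType k) (B : algType k)
    (f : U -> B) (g : V -> B) :
  linear f -> linear g -> linear (tprod f g).
Proof.
by move=> lf lg; apply: tlift_linear; split=> x; [exact: lin_mulr | exact: lin_mull].
Qed.

(** The values of [g] on the first argument have to move past those of [f] on the
    second, hence the commutative target. *)
Lemma tprodM (C D B : algType k) (f : C -> B) (g : D -> B) :
  (forall x y : B, x * y = y * x) -> linear f -> linear g ->
  {morph f : x y / x * y} -> {morph g : x y / x * y} ->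
  {morph tprod f g : t r / t * r}.
Proof.
move=> cB lf lg fM gM t r; have lfg := tprod_linear lf lg.
move: t; apply: tensor_ext => [||c d].
- by apply: (lin_comp lfg); exact: lin_mulr.
- exact: lin_mulr.
move: r; apply: tensor_ext => [||c' d'].
- by apply: (lin_comp lfg); exact: lin_mull.
- exact: lin_mull.
rewrite tensM !tprod_tens // fM gM -!mulrA; congr (_ * _).
by rewrite mulrA (cB (f c')) -mulrA.
Qed.

Lemma eq_tprod (U V : lmodType k) (B : algType k)
    (f f' : U -> B) (g g' : V -> B) :
  f =1 f' -> g =1 g' -> tprod f g =1 tprod f' g'.
Proof. by move=> ff' gg'; apply: eq_tlift => u v; rewrite ff' gg'. Qed.

Lemma tprod3E (U V W : lmodType k) (B : algType k)
    (f : U -> B) (g : V -> B) (h : W -> B) t :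
  tprod (tprod f g) h t = tlift3 (fun u v w => f u * g v * h w) t.
Proof. by apply: eq_bigr => p _; rewrite [LHS]mulr_suml. Qed.

Lemma tprod_tmap (U V U' V' : lmodType k) (B : algType k)
    (f : U' -> B) (g : V' -> B) (p : U -> U') (q : V -> V') :
  linear f -> linear g -> linear p -> linear q ->
  tprod f g \o tmap p q =1 tprod (f \o p) (g \o q).
Proof.
move=> lf lg lp lq; apply: tensor_ext => [||u v].
- exact: (lin_comp (tprod_linear lf lg) (tmap_linear lp lq)).
- exact: (tprod_linear (lin_comp lf lp) (lin_comp lg lq)).
by rewrite /= tmap_tens // !tprod_tens //; exact: lin_comp.
Qed.

Lemma tprod_tassoc (U V W : lmodType k) (B : algType k)
    (f : U -> B) (g : V -> B) (h : W -> B) :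
  linear f -> linear g -> linear h ->
  tprod (tprod f g) h \o @tassoc k U V W =1 tprod f (tprod g h).
Proof.
move=> lf lg lh; have lfg := tprod_linear lf lg; have lgh := tprod_linear lg lh.
have lL := lin_comp (tprod_linear lfg lh) (@tassoc_linear _ U V W).
have lR := tprod_linear lf lgh.
apply: tensor_ext => // u t; move: t; apply: tensor_ext => [||v w].
- exact: (lin_comp lL (tens_linearr u)).
- exact: (lin_comp lR (tens_linearr u)).
by rewrite /= tassoc_tens !tprod_tens // mulrA.
Qed.

End CommutativeTarget.

(** In a commutative algebra, conjugation by [Phi] is trivial. *)
Lemma coassoc_of_comm (k : fieldType) (A : algType k)
    (Delta : {lrmorphism A -> A ⊗ A}) (eps : {lrmorphism A -> k | *%R})
    (Phi phi : A ⊗ A ⊗ A) :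
  quasi_bialgebra Delta eps Phi phi -> (forall a b : A, a * b = b * a) ->
  forall a, tassoc (tmap id Delta (Delta a)) = tmap Delta id (Delta a).
Proof.
move=> HA cA a; have cAA := tens_comm cA cA.
rewrite -[LHS]mulr1 -(qb_mulV HA) mulrA (qb_coassoc HA) [Phi * _](tens_comm cAA cA).
by rewrite -mulrA (qb_mulV HA) mulr1.
Qed.

(** * The antipode of a commutative quasi-bialgebra with preantipode *)

Section Twist.
Variables (k : fieldType) (A : algType k).
Variables (Delta : {lrmorphism A -> A ⊗ A}) (eps : {lrmorphism A -> k | *%R}).
Variables (Phi : A ⊗ A ⊗ A) (S : A -> A).
Hypothesis HS : preantipode Delta eps Phi S.
Hypothesis cA : forall a b : A, a * b = b * a.

Definition twist (a : A) : A :=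
  tlift3 (fun x y z : A => x * S (a * y) * z) Phi.

Lemma twist_linear : linear twist.
Proof.
move=> c a b; rewrite /twist /tlift3 /tlift scaler_sumr -big_split.
apply: eq_bigr => p _; rewrite /= scaler_sumr -big_split; apply: eq_bigr => q _ /=.
rewrite mulrDl -scalerAl (pa_linear HS) mulrDr mulrDl.
by rewrite -scalerAr -scalerAl.
Qed.

Lemma twist1 : twist 1 = 1.
Proof. by rewrite -[RHS](pa_Phi HS); apply: eq_tlift3 => x y z; rewrite mul1r. Qed.

(** Commutativity lets both legs of [Delta a] slide past [Phi^1], [Phi^2], [Phi^3]
    onto [S], where the corresponding identity of the preantipode applies. *)
Lemma twist_absorbl (a b : A) :
  tlift (fun x y => x * twist (b * y)) (Delta a) = eps a *: twist b.
Proof.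
rewrite (eq_tlift (g := fun x y =>
  tlift3 (fun u v w => u * (x * S (b * v * y)) * w) Phi)); last first.
  move=> x y; rewrite (linear_tlift3 (g := fun t => x * t)); last exact: lin_mull.
  apply: eq_tlift3 => u v w; rewrite -(mulrA b) (cA y v) !mulrA.
  by rewrite (cA x u).
rewrite exchange_tlift3 (linear_tlift3 (g := fun t => eps a *: t));
  last exact: lin_scaler.
apply: eq_tlift3 => u v w.
rewrite -(linear_tlift (g := fun t => u * t * w)) ?(pa_left HS).
  by rewrite -scalerAr -scalerAl.
by apply: lin_mulr; exact: lin_mull.
Qed.

Lemma twist_absorbr (a b : A) :
  tlift (fun x y => twist (x * b) * y) (Delta a) = eps a *: twist b.
Proof.
rewrite (eq_tlift (g := fun x y =>
  tlift3 (fun u v w => u * (S (x * (b * v)) * y) * w) Phi)); last first.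
  move=> x y; rewrite (linear_tlift3 (g := fun t => t * y)); last exact: lin_mulr.
  by apply: eq_tlift3 => u v w; rewrite -!mulrA (cA y w).
rewrite exchange_tlift3 (linear_tlift3 (g := fun t => eps a *: t));
  last exact: lin_scaler.
apply: eq_tlift3 => u v w.
rewrite -(linear_tlift (g := fun t => u * t * w)) ?(pa_right HS).
  by rewrite -scalerAr -scalerAl.
by apply: lin_mulr; exact: lin_mull.
Qed.

End Twist.

Section Antipode.
Variables (k : fieldType) (A : algType k).
Variables (Delta : {lrmorphism A -> A ⊗ A}) (eps : {lrmorphism A -> k | *%R}).
Variable s : A -> A.
Hypothesis Hs : hopf_algebra Delta eps s.

Let lD : linear Delta. Proof. exact: linearP. Qed.
Let ls : linear s. Proof. exact: hopf_linear Hs. Qed.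
Let lid (V : lmodType k) : linear (@id V). Proof. by []. Qed.

Let eta (a : A) : A := (eps a)%:A.
Let leta : linear eta. Proof. exact: lin_scale. Qed.

Let antipodel : tprod s id \o Delta =1 eta.
Proof. exact: hopf_antipodel Hs. Qed.

Let antipoder : tprod id s \o Delta =1 eta.
Proof. exact: hopf_antipoder Hs. Qed.

(** Evaluating [s a_1 * a_2 * F (b * a_3)] by contracting the first two factors
    gives the left-hand side, by contracting the last two the right-hand side. *)
Lemma absorb_antipode (F : A -> A) :
  linear F ->
  (forall a b, tlift (fun x y => x * F (b * y)) (Delta a) = eps a *: F b) ->
  forall a b, F (b * a) = s a * F b.
Proof.
move=> lF HF a b; pose G z := F (b * z).
have lG : linear G by apply: (lin_comp lF); exact: lin_mull.
pose E := tprod (tprod s id) G.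
have lsi : linear (tprod s id) by exact: tprod_linear.
have lig : linear (tprod id G) by exact: tprod_linear.
transitivity (E (tmap Delta id (Delta a))).
  rewrite [RHS]tprod_tmap // (eq_tprod antipodel (frefl _)).
  rewrite -[LHS]/(G a) -{1}(hopf_counitl Hs a) (linear_tlift (g := G)) //.
  by apply: eq_tlift => x y; rewrite /= -scalerAl mul1r; exact: linZ.
rewrite -(hopf_coassoc Hs) [LHS]tprod_tassoc // [LHS]tprod_tmap //.
rewrite (eq_tprod (frefl _) (HF^~ b)) -{2}(hopf_counitr Hs a).
rewrite (linear_tlift (g := fun x => s x * F b)); last exact: lin_mulr.
by apply: eq_tlift => x y; rewrite (linZ _ _ ls) -scalerAl scalerAr.
Qed.

Lemma antipode1 : s 1 = 1.
Proof.
have := antipodel 1; rewrite /= rmorph1 tens1 tprod_tens // mulr1 => ->.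
by rewrite /eta rmorph1 scale1r.
Qed.

Section Pentagon.
Variables Phi phi : A ⊗ A ⊗ A.
Hypothesis HA : quasi_bialgebra Delta eps Phi phi.
Hypothesis cA : forall a b : A, a * b = b * a.
Hypothesis sM : {morph s : a b / a * b}.

Let idM : {morph @id A : a b / a * b}. Proof. by []. Qed.
Let lsi : linear (tprod s id). Proof. exact: tprod_linear. Qed.
Let lis : linear (tprod id s). Proof. exact: tprod_linear. Qed.
Let siM : {morph tprod s id : t r / t * r}. Proof. exact: tprodM. Qed.
Let lsis : linear (tprod (tprod s id) s). Proof. exact: tprod_linear. Qed.
Let sisM : {morph tprod (tprod s id) s : t r / t * r}.
Proof. exact: tprodM. Qed.

Let si1 : tprod s id (1 ⊗ 1) = 1.
Proof. by rewrite tprod_tens // antipode1 mulr1. Qed.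

(** Evaluate the pentagon under the algebra map
    [x ⊗ y ⊗ z ⊗ w |-> s x * y * s z * w].  A coproduct placed in two adjacent
    slots meets one [s] and one identity there, so it contracts to a counit,
    and the counit axiom for [Phi] makes the whole factor equal to 1.  Only the
    images of [1 ⊗ Phi] and [Phi ⊗ 1] survive. *)
Lemma pentagon_antipode :
  tprod (tprod id s) id Phi * tprod (tprod s id) s Phi = 1.
Proof.
pose f := tprod (tprod (tprod s id) s) (@id A).
have lf : linear f by exact: tprod_linear.
have fM : {morph f : t r / t * r} by exact: tprodM.
have lt U V W := @tassoc_linear k U V W.
have lDl : linear (tmap Delta (@id A)) by exact: tmap_linear.
have lDr : linear (tmap (@id A) Delta) by exact: tmap_linear.
have := congr1 f (qb_pentagon HA); rewrite !fM.
have -> : f (tassoc (tmap id Delta Phi)) = 1.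
  rewrite [LHS]tprod_tassoc // [LHS]tprod_tmap // (eq_tprod (frefl _) antipodel).
  rewrite tprod3E -si1 -(qb_counit3 HA) (linear_tlift3 (g := tprod s id)) //.
  apply: eq_tlift3 => x y z.
  by rewrite (linZ _ _ lsi) tprod_tens // -scalerAr mulr1.
have -> : f (tmap (tmap Delta id) id Phi) = 1.
  rewrite [LHS]tprod_tmap // (eq_tprod (tprod_tmap lsi ls lD (lid (V := A))) (frefl _)).
  rewrite (eq_tprod (eq_tprod antipodel (frefl _)) (frefl _)).
  rewrite tprod3E -si1 -(qb_counit1 HA) (linear_tlift3 (g := tprod s id)) //.
  apply: eq_tlift3 => x y z.
  by rewrite (linZ _ _ lsi) tprod_tens // -!scalerAl mul1r.
have -> : f (tmap (@tassoc k A A A \o tmap id Delta) id Phi) = 1.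
  have ltD := lin_comp (lt A A A) lDr.
  rewrite [LHS]tprod_tmap //.
  have E : tprod (tprod s id) s \o (@tassoc k A A A \o tmap id Delta)
      =1 tprod s eta.
    move=> t; rewrite [LHS]tprod_tassoc // [LHS]tprod_tmap //.
    exact: (eq_tprod (frefl _) antipoder).
  rewrite (eq_tprod E (frefl _)).
  rewrite tprod3E -si1 -(qb_counit2 HA) (linear_tlift3 (g := tprod s id)) //.
  apply: eq_tlift3 => x y z.
  by rewrite (linZ _ _ lsi) tprod_tens // -scalerAr -scalerAl mulr1.
have -> : f (Phi ⊗ 1) = tprod (tprod s id) s Phi.
  by rewrite [LHS]tprod_tens // mulr1.
have -> : f (tmap (@tassoc k A A A) id (tassoc (1 ⊗ Phi)))
    = tprod (tprod id s) id Phi.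
  transitivity (tprod (tprod s (tprod id s)) (@id A) (tassoc (1 ⊗ Phi))).
    rewrite [LHS]tprod_tmap //; last exact: lt.
    by apply: eq_tprod => // t; exact: tprod_tassoc.
  have lisi : linear (tprod (tprod id s) (@id A)) by exact: tprod_linear.
  rewrite [LHS]tprod_tassoc //.
  by rewrite tprod_tens // antipode1 mul1r.
by rewrite !mulr1 => <-.
Qed.

(** Multiplying [x ⊗ y ⊗ z |-> x * s y * z] by [beta] makes [beta] the inverse of
    its value at [Phi]; the pentagon identity then says that [beta] is also the
    value at [Phi] of the algebra map [x ⊗ y ⊗ z |-> s x * y * s z]. *)
Lemma beta_reassociator_inv (beta : A) :
  tlift3 (fun x y z : A => x * beta * s y * z) Phi = 1 ->
  tlift3 (fun x y z : A => s x * y * beta * s z) phi = 1.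
Proof.
have lbeta : linear (fun a => beta * a) by exact: lin_mull.
rewrite (eq_tlift3 (g := fun x y z => beta * (x * s y * z))); last first.
  by move=> x y z; rewrite (cA x) !mulrA.
rewrite -(linear_tlift3 (g := fun a => beta * a)) // -(tprod3E id s id).
set p := tprod _ _ _ => bp1.
rewrite (eq_tlift3 (g := fun x y z => beta * (s x * y * s z))); last first.
  by move=> x y z; rewrite -mulrA [_ * (beta * _)]mulrA (cA (_ * y)) !mulrA.
rewrite -(linear_tlift3 (g := fun a => beta * a)) // -(tprod3E s id s).
have -> : beta = tprod (tprod s id) s Phi.
  by rewrite -[LHS]mulr1 -pentagon_antipode mulrA bp1 mul1r.
by rewrite -sisM (qb_mulV HA) !tens1 !tprod_tens // antipode1 !mulr1.
Qed.

End Pentagon.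
End Antipode.

(** * The Hopf and quasi-Hopf structures *)

Unset Implicit Arguments.

Theorem corollary4p14 (k : fieldType) (A : algType k)
    (Delta : {lrmorphism A -> A ⊗ A}) (eps : {lrmorphism A -> k | *%R})
    (Phi phi : A ⊗ A ⊗ A) (S : A -> A)
    (HA : quasi_bialgebra Delta eps Phi phi)
    (HS : preantipode Delta eps Phi S)
    (HC : forall a b : A, a * b = b * a) :
  let s := fun a : A => tlift3 (fun x y z : A => x * S (a * y) * z) Phi in
  let alpha : A := 1 in
  let beta : A := S 1 in
  [/\ hopf_algebra Delta eps s,
      quasi_hopf_algebra Delta eps Phi phi s alpha beta,
      forall a : A, S a = beta * s a
    & exists s' : A -> A, hopf_algebra Delta eps s'].
Proof.
move=> s alpha beta.
have s1 : s 1 = 1 := twist1 HS.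
have antl a : tlift (fun x y => s x * y) (Delta a) = (eps a)%:A.
  rewrite -s1 -[RHS](twist_absorbr HS HC).
  by apply: eq_tlift => x y; rewrite mulr1.
have antr a : tlift (fun x y => x * s y) (Delta a) = (eps a)%:A.
  rewrite -s1 -[RHS](twist_absorbl HS HC).
  by apply: eq_tlift => x y; rewrite mul1r.
have Hs : hopf_algebra Delta eps s.
  split=> //; [exact: coassoc_of_comm HA HC | exact: qb_counitl HA |
    exact: qb_counitr HA | exact: twist_linear HS].
have Sbeta a : S a = beta * s a.
  (* the absorption lemma for F = S reads S (1 * a) = s a * S 1 at b = 1 *)
  rewrite HC -[in LHS](mul1r a).
  exact: (absorb_antipode Hs (pa_linear HS) (pa_left HS)).
have sM : {morph s : a b / a * b}.
  move=> a b; rewrite HC.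
  exact: (absorb_antipode Hs (hopf_linear Hs) (twist_absorbl HS HC)).
have beta_Phi : tlift3 (fun x y z => x * beta * s y * z) Phi = 1.
  rewrite -(pa_Phi HS); apply: eq_tlift3 => x y z.
  by rewrite Sbeta !mulrA.
split=> //; last by exists s.
split=> //.
- exact: hopf_linear Hs.
- by move=> a b; rewrite HC sM.
- by move=> a; rewrite -antl; apply: eq_tlift => x y; rewrite mulr1.
- move=> a; rewrite -(pa_left HS); apply: eq_tlift => x y.
  by rewrite mul1r Sbeta mulrA.
- by rewrite -beta_Phi; apply: eq_tlift3 => x y z; rewrite mulr1.
rewrite -(beta_reassociator_inv Hs HA HC sM beta_Phi).
by apply: eq_tlift3 => x y z; rewrite mulr1.
Qed.
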